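(* Let $m \le n$, $A \in \mathbb{R}^{m\times n}$, $Q \in \mathbb{R}^{n\times n}$ symmetric positive semi-definite, $\delta,\rho>0$, integers $0\le k_c\le n$ and $0\le k_r\le m$, and permutation matrices $\mathscr{P}_c\in\mathbb{R}^{n\times n}$, $\mathscr{P}_r\in\mathbb{R}^{m\times m}$ be given. Let $\widehat{M}$, $B$ (with blocks $B_{11},B_{12},B_{21},B_{22}$) and $P_{NE}=P_{NE,(k_c,k_r)}$ be the matrices constructed from these data as in the context. Then the preconditioned matrix $P_{NE}^{-1}\mathscr{P}_r \widehat{M} \mathscr{P}_r^\top$ has at least $\max\{m-(2k_r+k_c),0\}$ eigenvalues (counted with multiplicity) equal to $1$. Moreover: (i) if $k_c > 0$ and $k_r > 0$, all remaining eigenvalues lie in the interval $$ I_{k_c,k_r} = \left[\frac{\delta}{\delta+\sigma_{\max}^2(B)},\ 2 + \frac{\lambda_{\max}(B_{21}B_{21}^\top)}{\delta+\lambda_{\min}(B_{22}B_{22}^\top)}\right];$$ (ii) if $k_c > 0$ and $k_r = 0$, all remaining eigenvalues lie in the interval $$ I_{k_c} = \left[1,\ 1 + \frac{\lambda_{\max}(B_{21}B_{21}^\top)}{\delta+\lambda_{\min}(B_{22}B_{22}^\top)}\right];$$ (iii) if $k_r > 0$ and $k_c = 0$, all remaining eigenvalues lie in the interval $$ I_{k_r} = \left[\frac{\delta}{\delta+\sigma_{\max}^2(B)},\ 2 \right].$$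
   Context: Notation: $I_k$ is the $k\times k$ identity, $0_{p,q}$ the $p\times q$ zero matrix, $\mathrm{Diag}(N)$ the diagonal matrix with the same diagonal entries as $N$; $\lambda_{\min},\lambda_{\max}$ denote the minimum and maximum eigenvalue of a square matrix with real eigenvalues, and $\sigma_{\max}$ the maximum singular value. Approximation of $Q$: write $$Q = \mathscr{P}_c \begin{bmatrix} Q_1 & Q_3^\top\\ Q_3 & Q_2 \end{bmatrix}\mathscr{P}_c^\top, \qquad Q_1\in\mathbb{R}^{k_c\times k_c},\quad Q_2\in\mathbb{R}^{(n-k_c)\times(n-k_c)},$$ and set $$\widehat{Q} = \mathscr{P}_c\begin{bmatrix} \widehat{Q}_1 & 0_{k_c,n-k_c}\\ 0_{n-k_c,k_c} & \widehat{Q}_2 \end{bmatrix} \mathscr{P}_c^\top,$$ where $\widehat{Q}_1$ is either $Q_1$ or $\mathrm{Diag}(Q_1)$, and $\widehat{Q}_2$ is either $Q_2$ or $\mathrm{Diag}(Q_2)$ (any of these choices is allowed). Approximate normal equations: $\widehat{G} = (\widehat{Q}+\rho I_n)^{-1}$ and $\widehat{M} = A\widehat{G}A^\top + \delta I_m$. Block notation: $$B = \mathscr{P}_r A \widehat{G}^{1/2}\mathscr{P}_c = \begin{bmatrix} B_{11}& B_{12} \\ B_{21} & B_{22} \end{bmatrix},$$ with $B_{11} \in \mathbb{R}^{k_r \times k_c}$, $B_{12} \in \mathbb{R}^{k_r \times (n-k_c)}$, $B_{21} \in \mathbb{R}^{(m-k_r)\times k_c}$, $B_{22} \in \mathbb{R}^{(m-k_r)\times(n-k_c)}$,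 and $$\mathscr{P}_r \widehat{M} \mathscr{P}_r^\top = \begin{bmatrix} \widehat{M}_{11} & \widehat{M}_{21}^\top\\ \widehat{M}_{21} & \widehat{M}_{22} \end{bmatrix},$$ where $\widehat{M}_{11} = B_{11}B_{11}^\top + B_{12}B_{12}^\top + \delta I_{k_r}$, $\widehat{M}_{21} = B_{21}B_{11}^\top + B_{22}B_{12}^\top$, $\widehat{M}_{22} = B_{21}B_{21}^\top + B_{22}B_{22}^\top + \delta I_{m-k_r}$. Preconditioner: $$P_{NE} = P_{NE,(k_c,k_r)} = \begin{bmatrix} \widehat{M}_{11} & 0_{k_r, m-k_r} \\ 0_{m-k_r,k_r} & \widetilde{M}_{22} \end{bmatrix}, \qquad \widetilde{M}_{22} = \widehat{M}_{22} - B_{21}B_{21}^\top .$$ Conventions for zero-dimensional blocks: blocks with a zero dimension are absent, and a product $XX^\top$ with $X$ having no columns is the zero matrix. In particular, if $k_c=0$ then $B_{11},B_{21}$ are absent and $P_{NE,(0,k_r)}$ is the block diagonal matrix with blocks $\widehat{M}_{11},\widehat{M}_{22}$; if $k_r=0$ then $B_{11},B_{12}$ are absent and $P_{NE,(k_c,0)}=\widetilde{M}_{22}$. If $k_r=m$, the blocks $B_{21},B_{22}$ have no rows and the fraction $\lambda_{\max}(B_{21}B_{21}^\top)/(\delta+\lambda_{\min}(B_{22}B_{22}^\top))$ is read as $0$. *)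

(* Defs.v *)
From HB Require Import structures.
From mathcomp Require Import all_boot all_order all_algebra.
From mathcomp Require Import all_classical all_reals.

Set Implicit Arguments.
Unset Strict Implicit.
Unset Printing Implicit Defensive.

Import Order.TTheory GRing.Theory Num.Theory.
Local Open Scope classical_set_scope.
Local Open Scope ring_scope.

Section LinearAlgebra.
Context {R : realType}.

(* [s] lists the eigenvalues of [N] with algebraic multiplicity; the splitting
   over [R] says in particular that all complex eigenvalues of [N] are real. *)
Definition eigenvalues_with_mult k (N : 'M[R]_k) (s : seq R) : Prop :=
  char_poly N = \prod_(a <- s) ('X - a%:P).

(* The set of eigenvalues is finite, so [sup] and [inf] are a maximum and a
   minimum when it is nonempty; for the 0 x 0 matrix both are 0. *)
Definition lambda_max k (N : 'M[R]_k) : R := sup [set a | eigenvalue N a].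
Definition lambda_min k (N : 'M[R]_k) : R := inf [set a | eigenvalue N a].

Definition sigma_max p q (N : 'M[R]_(p, q)) : R :=
  Num.sqrt (lambda_max (N^T *m N)).

Definition psdmx k (N : 'M[R]_k) : Prop :=
  N \is symmetricmx /\ forall x : 'cV[R]_k, 0 <= (x^T *m N *m x) 0 0.

(* The principal square root, which exists and is unique for [N] symmetric
   positive semi-definite; 0 by default if there is none. *)
Definition sqrtmx k (N : 'M[R]_k) : 'M[R]_k :=
  xget 0 [set S | psdmx S /\ S *m S = N].

Definition Diag k (N : 'M[R]_k) : 'M[R]_k := diag_mx (\row_i N i i).

End LinearAlgebra.

(* The paper's m and n are [kr + mr] and [kc + nc], so that m - k_r = mr and
   n - k_c = nc. *)
Section Preconditioner.
Context {R : realType} {kr mr kc nc : nat}.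
Variables (A : 'M[R]_(kr + mr, kc + nc)) (rho delta : R).
Variables (Pc : 'M[R]_(kc + nc)) (Pr : 'M[R]_(kr + mr)).

(* As Pc is orthogonal, Q = Pc [Q1 Q3^T; Q3 Q2] Pc^T means that these are the
   diagonal blocks of Pc^T Q Pc. *)
Definition Q1 (Q : 'M[R]_(kc + nc)) : 'M[R]_kc := ulsubmx (Pc^T *m Q *m Pc).
Definition Q2 (Q : 'M[R]_(kc + nc)) : 'M[R]_nc := drsubmx (Pc^T *m Q *m Pc).

Definition Qhat (Qh1 : 'M[R]_kc) (Qh2 : 'M[R]_nc) : 'M[R]_(kc + nc) :=
  Pc *m block_mx Qh1 0 0 Qh2 *m Pc^T.

Definition Ghat (Qh : 'M[R]_(kc + nc)) : 'M[R]_(kc + nc) :=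
  invmx (Qh + rho%:M).

Definition Mhat (Qh : 'M[R]_(kc + nc)) : 'M[R]_(kr + mr) :=
  A *m Ghat Qh *m A^T + delta%:M.

Definition Bmx (Qh : 'M[R]_(kc + nc)) : 'M[R]_(kr + mr, kc + nc) :=
  Pr *m A *m sqrtmx (Ghat Qh) *m Pc.

Section Blocks.
Variable B : 'M[R]_(kr + mr, kc + nc).
Let B11 : 'M[R]_(kr, kc) := ulsubmx B.
Let B12 : 'M[R]_(kr, nc) := ursubmx B.
Let B21 : 'M[R]_(mr, kc) := dlsubmx B.
Let B22 : 'M[R]_(mr, nc) := drsubmx B.

Definition Mhat11 : 'M[R]_kr := B11 *m B11^T + B12 *m B12^T + delta%:M.
Definition Mhat22 : 'M[R]_mr := B21 *m B21^T + B22 *m B22^T + delta%:M.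
Definition Mtilde22 : 'M[R]_mr := Mhat22 - B21 *m B21^T.

Definition PNE : 'M[R]_(kr + mr) := block_mx Mhat11 0 0 Mtilde22.
End Blocks.

End Preconditioner.

(* Main.v *)
Require Import Defs.
From HB Require Import structures.
From mathcomp Require Import all_boot all_order all_algebra.
From mathcomp Require Import all_classical all_reals.
From mathcomp Require Import complex spectral sesquilinear fingroup perm.
From mathcomp Require Import ring lra.

(** Since [Pc] and [Pr] are orthogonal and [Ghat] is positive definite, hence
    has a square root, the permuted normal matrix is the regularized Gram
    matrix [W = B *m B^T + delta%:M] ([normal_matrix_gram]).  From there on
    only [B] and [delta] matter.

    The preconditioner [P] is symmetric positive definite, so [P] and [W] are
    simultaneously diagonalized by a congruence
    ([simultaneous_diagonalization]).  Hence [P^-1 W] is diagonalizable with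
    real eigenvalues, each of them is the quotient of the quadratic forms of
    [W] and [P] at some vector, and the multiplicity of 1 is the corank of
    [W - P] ([pencil_eigenvalues]).  The theorem is thus reduced to a rank
    bound and to inequalities between two quadratic forms.

    Rank: [W - P] has a zero upper left block and lower right block
    [B21 *m B21^T], which factors through the [kc] columns of [B21]; its rank
    is at most [kr] for the upper rows plus [kr + kc] for the lower rows.

    Lower bound: the form of [W] is at least [delta * |z|^2].  As a part of [B],
    neither the block row of [B11] and [B12] nor [B22] has norm exceeding
    [sigma_max B], so the form of [P] is at most
    [(delta + sigma_max B ^+ 2) * |z|^2].

    Upper bound: write [z = (x, y)], let [p] be the form of [P] at [(x, 0)] and
    [q] its form at [(0, y)].  The form of [W] at [(x, 0)] is [p]; at [(0, y)]
    it is [q + |B21^T y|^2 <= (1 + f) q], where [f] is the fraction in the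
    statement.  As the form of [W] is the square of a Euclidean norm, the
    triangle inequality followed by Cauchy-Schwarz gives
    [(sqrt p + sqrt ((1 + f) q))^2 <= (2 + f) (p + q)].  If [kr = 0] there is
    no [x], and the form of [W] lies between [q] and [(1 + f) q]; if [kc = 0]
    the block [B21] has no columns and [f] may be replaced by 0. *)

Set Implicit Arguments.
Unset Strict Implicit.
Unset Printing Implicit Defensive.

Import Order.TTheory GRing.Theory Num.Theory.
Local Open Scope ring_scope.

(** * Squared norms and quadratic forms *)

Definition normsq (R : pzSemiRingType) p (x : 'cV[R]_p) : R := (x^T *m x) 0 0.

Definition qform (R : pzSemiRingType) p (N : 'M[R]_p) (x : 'cV[R]_p) : R :=
  (x^T *m N *m x) 0 0.

Section Forms.
Variable R : comNzRingType.

Lemma normsqE p (x : 'cV[R]_p) : normsq x = \sum_i x i 0 ^+ 2.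
Proof. by rewrite /normsq mxE; apply: eq_bigr => i _; rewrite mxE expr2. Qed.

Lemma normsq0 p : normsq (0 : 'cV[R]_p) = 0.
Proof. by rewrite /normsq mulmx0 mxE. Qed.

Lemma normsq_col_mx p q (x : 'cV[R]_p) (y : 'cV[R]_q) :
  normsq (col_mx x y) = normsq x + normsq y.
Proof. by rewrite /normsq tr_col_mx mul_row_col mxE. Qed.

Lemma normsq_orthogonal k (U : 'M[R]_k) (x : 'cV[R]_k) : U *m U^T = 1%:M ->
  normsq (U *m x) = normsq x.
Proof.
by move=> /mulmx1C UU; rewrite /normsq trmx_mul -mulmxA (mulmxA U^T) UU mul1mx.
Qed.

Lemma qformDscalar p (N : 'M[R]_p) a (x : 'cV[R]_p) :
  qform (N + a%:M) x = qform N x + a * normsq x.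
Proof.
by rewrite /qform mulmxDr mulmxDl mxE mul_mx_scalar -scalemxAl [X in _ + X]mxE.
Qed.

Lemma qform_gram p q (X : 'M[R]_(p, q)) (x : 'cV[R]_p) :
  qform (X *m X^T) x = normsq (X^T *m x).
Proof. by rewrite /qform /normsq trmx_mul trmxK !mulmxA. Qed.

Lemma qform_diag k (d : 'rV[R]_k) (x : 'cV[R]_k) :
  qform (diag_mx d) x = \sum_i d 0 i * x i 0 ^+ 2.
Proof.
rewrite /qform -mulmxA mul_diag_mx mxE; apply: eq_bigr => i _.
by rewrite !mxE; ring.
Qed.

Lemma qform_orthodiag k (U : 'M[R]_k) (d : 'rV[R]_k) (x : 'cV[R]_k) :
  qform (U^T *m diag_mx d *m U) x = qform (diag_mx d) (U *m x).
Proof. by rewrite /qform trmx_mul !mulmxA. Qed.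

End Forms.

Section NormSqOrder.
Variable R : realDomainType.

Lemma normsq_ge0 p (x : 'cV[R]_p) : 0 <= normsq x.
Proof. by rewrite normsqE sumr_ge0 // => i _; rewrite sqr_ge0. Qed.

Lemma normsq_eq0 p (x : 'cV[R]_p) : (normsq x == 0) = (x == 0).
Proof.
apply/idP/idP => [|/eqP->]; last by rewrite /normsq mulmx0 mxE.
rewrite normsqE psumr_eq0 => [/allP x0|i _]; last exact: sqr_ge0.
apply/eqP/matrixP => i j; rewrite (ord1 j) mxE; apply/eqP.
by rewrite -sqrf_eq0; apply: (implyP (x0 i _)); rewrite ?mem_index_enum.
Qed.

Lemma normsq_gt0 p (x : 'cV[R]_p) : (0 < normsq x) = (x != 0).
Proof. by rewrite lt_neqAle normsq_ge0 andbT eq_sym normsq_eq0. Qed.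

End NormSqOrder.

(** The weighted form of the triangle inequality: the difference of the two
    sides is [t^-1 * normsq (t *: x - y)]. *)
Lemma normsqD_le (R : realFieldType) p (x y : 'cV[R]_p) t : 0 < t ->
  normsq (x + y) <= (1 + t) * normsq x + (1 + t^-1) * normsq y.
Proof.
move=> t0; rewrite !normsqE !mulr_sumr -big_split /=; apply: ler_sum => i _.
rewrite !mxE -subr_ge0.
set a := x i 0; set b := y i 0.
have -> : (1 + t) * a ^+ 2 + (1 + t^-1) * b ^+ 2 - (a + b) ^+ 2
          = t^-1 * (t * a - b) ^+ 2 by field; rewrite gt_eqF.
by rewrite mulr_ge0 ?sqr_ge0 // invr_ge0 ltW.
Qed.

(** * The spectral theorem for real symmetric matrices *)

Lemma symmetric_trP (F : fieldType) k (N : 'M[F]_k) :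
  reflect (N^T = N) (N \is symmetricmx).
Proof.
apply: (iffP (is_hermitianmxP _ _ _)).
  by rewrite expr0 scale1r map_mx_id.
by rewrite expr0 scale1r map_mx_id.
Qed.

(** Over the complex numbers the matrix is Hermitian, hence unitarily
    diagonalizable with real eigenvalues; a real eigenvalue of the complexified
    matrix is one of the matrix itself. *)
Lemma symmetric_has_eigenvalue (R : rcfType) k (N : 'M[R]_k.+1) :
  N^T = N -> exists a, eigenvalue N a.
Proof.
move=> Nsym; pose C := (R[i])%C; pose f : {rmorphism R -> C} := real_complex R.
pose NC : 'M[C]_k.+1 := map_mx f N.
have NCherm : NC \is hermsymmx.
  apply: realsym_hermsym.
    by apply/symmetric_trP; rewrite map_trmx Nsym.
  by apply/mxOverP => i j; rewrite mxE complex_real.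
have /orthomx_spectralP NCE := hermitian_normalmx NCherm.
have /mxOverP/(_ 0 0)/complex_realP[a da] :=
  hermitian_spectral_diag_real NCherm.
exists a; rewrite -(eigenvalue_map f).
apply/eigenvalueP; exists (row 0 (spectralmx NC)).
  have PN : spectralmx NC *m NC = diag_mx (spectral_diag NC) *m spectralmx NC.
    by rewrite {2}NCE -!mulmxA mulKVmx ?spectral_unit.
  by rewrite -row_mul PN row_mul row_diag_mx da -scalemxAl -rowE.
apply/negP => /eqP r0; have /row_freeP[P' PP'] : row_free (spectralmx NC).
  by rewrite row_free_unit spectral_unit.
move: PP' => /(congr1 (row 0)); rewrite row_mul r0 mul0mx => /matrixP/(_ 0 0).
by rewrite !mxE eqxx => /eqP; rewrite eq_sym oner_eq0.
Qed.

Lemma reflection_involutive (F : fieldType) k (w : 'rV[F]_k) (c : F) :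
  w *m w^T = c%:M -> c != 0 ->
  (1%:M - (2 / c) *: (w^T *m w)) *m (1%:M - (2 / c) *: (w^T *m w)) = 1%:M.
Proof.
move=> wwT c0; have XX : w^T *m w *m (w^T *m w) = c *: (w^T *m w).
  by rewrite mulmxA -(mulmxA w^T) wwT mul_mx_scalar -scalemxAl.
rewrite mulmxBl mul1mx mulmxBr mulmx1 -scalemxAl -scalemxAr XX !scalerA.
rewrite -mulrA divfK // opprB addrAC -addrA.
by rewrite -!scalerBl (_ : _ - _ - _ = 0) ?scale0r ?addr0 //; ring.
Qed.

(** The reflection along [v - e], where [e] is the first basis vector, exchanges
    the unit vectors [e] and [v]. *)
Lemma householder (R : rcfType) k (v : 'rV[R]_(1 + k)) : v *m v^T = 1%:M ->
  exists H : 'M[R]_(1 + k),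
    [/\ H^T = H, H *m H = 1%:M & row_mx 1%:M 0 *m H = v].
Proof.
move=> v1; have : (row_mx 1%:M 0 : 'rV[R]_(1 + k)) *m (row_mx 1%:M 0)^T = 1%:M.
  by rewrite tr_row_mx mul_row_col trmx1 mul1mx trmx0 mulmx0 addr0.
move: (row_mx 1%:M 0) => e e1.
have [ve|nve] := eqVneq v e.
  by exists 1%:M; rewrite trmx1 !mulmx1 ve.
have [w wE] : exists w, w = v - e by exists (v - e).
pose c := (w *m w^T) 0 0.
have wwT : w *m w^T = c%:M by rewrite [LHS]mx11_scalar.
have c0 : c != 0.
  have -> : c = normsq w^T by rewrite /c /normsq trmxK.
  by rewrite normsq_eq0 -trmx0 (inj_eq trmx_inj) wE subr_eq0.
have ewT : 2 * (e *m w^T) 0 0 = - c.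
  have evT : e *m v^T = v *m e^T.
    by rewrite [RHS]mx11_scalar -tr_scalar_mx -mx11_scalar trmx_mul trmxK.
  rewrite /c wE linearB /= mulmxBl !mulmxBr evT v1 e1 !mxE eqxx.
  ring.
exists (1%:M - (2 / c) *: (w^T *m w)); split.
- by rewrite linearB linearZ /= trmx1 trmx_mul trmxK.
- exact: reflection_involutive.
- rewrite mulmxBr mulmx1 -scalemxAr mulmxA (mx11_scalar (e *m w^T)).
  rewrite mul_scalar_mx scalerA mulrAC ewT mulNr divff // scaleN1r opprK.
  by rewrite wE addrC subrK.
Qed.

(** By induction on the size: a Householder reflection moves a unit eigenvector
    to the first basis vector, and symmetry then makes the reflected matrix
    block diagonal. *)
Theorem spectral_theorem (R : rcfType) k (N : 'M[R]_k) : N^T = N ->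
  exists (U : 'M[R]_k) (d : 'rV[R]_k),
    U *m U^T = 1%:M /\ N = U^T *m diag_mx d *m U.
Proof.
elim: k => [|k IHk] in N *.
  by exists 1%:M, 0; split; apply/matrixP => -[].
(* The size is put in the form [1 + k] that block matrices need. *)
move: N; rewrite -[k.+1]/(1 + k)%N => N Nsym.
have [a /eigenvalueP[v vN v0]] := symmetric_has_eigenvalue Nsym.
pose u : 'rV[R]_(1 + k) := (Num.sqrt (normsq v^T))^-1 *: v.
have uN : u *m N = a *: u by rewrite -scalemxAl vN scalerA mulrC -scalerA.
have u1 : u *m u^T = 1%:M.
  rewrite linearZ /= -scalemxAl -scalemxAr scalerA -invfM -expr2.
  rewrite sqr_sqrtr ?normsq_ge0 // [v *m _]mx11_scalar -{2}[v]trmxK.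
  rewrite -[(_ *m _) 0 0]/(normsq v^T) scale_scalar_mx mulVf //.
  by rewrite normsq_eq0 -trmx0 (inj_eq trmx_inj).
have [H [HT HH eH]] := householder u1.
pose N1 : 'M[R]_(1 + k) := H *m N *m H.
have N1sym : N1^T = N1 by rewrite /N1 !trmx_mul HT Nsym mulmxA.
have eN1 : row_mx 1%:M 0 *m N1 = a *: row_mx 1%:M 0.
  rewrite /N1 !mulmxA eH uN -scalemxAl; congr (_ *: _).
  by rewrite -eH -mulmxA HH mulmx1.
have [N1ul N1ur] : ulsubmx N1 = a%:M /\ ursubmx N1 = 0.
  move: eN1; rewrite -{1}[N1]submxK mul_row_block !mul1mx !mul0mx !addr0.
  by rewrite scale_row_mx scaler0 scalemx1 => /eq_row_mx.
have N1dl : dlsubmx N1 = 0.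
  by rewrite -[LHS]trmxK trmx_dlsub N1sym N1ur trmx0.
have N1dr : (drsubmx N1)^T = drsubmx N1 by rewrite trmx_drsub N1sym.
have [U [d [UU N2E]]] := IHk _ N1dr.
pose V : 'M[R]_(1 + k) := block_mx 1%:M 0 0 U.
exists (V *m H), (row_mx a%:M d); split.
  rewrite trmx_mul HT mulmxA -(mulmxA V) HH mulmx1 /V tr_block_mx mulmx_block.
  rewrite !trmx0 trmx1 !mulmx0 !mul0mx !mulmx1 UU.
  by rewrite !addr0 add0r -scalar_mx_block.
have NE : N = H *m N1 *m H by rewrite /N1 !mulmxA HH mul1mx -mulmxA HH mulmx1.
rewrite [LHS]NE trmx_mul HT -!mulmxA; congr (_ *m _); rewrite !mulmxA.
congr (_ *m _); rewrite -[LHS]submxK N1ul N1ur N1dl N2E.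
rewrite diag_mx_row /V tr_block_mx !mulmx_block trmx1 !trmx0.
rewrite !(mulmx0, mul0mx, mulmx1, mul1mx, addr0, add0r).
by congr block_mx; apply/matrixP => i j; rewrite !ord1 !mxE eqxx.
Qed.

Lemma char_poly_conj (R : comNzRingType) k (N V W : 'M[R]_k) :
  V *m W = 1%:M -> char_poly (V *m N *m W) = char_poly N.
Proof.
move=> VW; rewrite /char_poly.
have VWC : map_mx polyC V *m map_mx polyC W = 1%:M.
  by rewrite -map_mxM VW map_mx1.
have -> : char_poly_mx (V *m N *m W)
          = map_mx polyC V *m char_poly_mx N *m map_mx polyC W.
  rewrite /char_poly_mx !map_mxM mulmxBr mulmxBl; congr (_ - _).
  by rewrite mul_mx_scalar -scalemxAl VWC scalemx1.
by rewrite !det_mulmx mulrAC -det_mulmx VWC det1 mul1r.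
Qed.

Lemma char_poly_diag (R : comNzRingType) k (d : 'rV[R]_k) :
  char_poly (diag_mx d) = \prod_i ('X - (d 0 i)%:P).
Proof.
rewrite char_poly_trig ?diag_mx_is_trig //.
by apply: eq_bigr => i _; rewrite !mxE eqxx.
Qed.

Section RealClosed.
Variables (R : rcfType) (k : nat).
Implicit Types (N P U : 'M[R]_k) (d : 'rV[R]_k).

Lemma eigenvalue_orthodiag U d a : U *m U^T = 1%:M ->
  eigenvalue (U^T *m diag_mx d *m U) a <-> exists i, a = d 0 i.
Proof.
move=> /mulmx1C UU; rewrite eigenvalue_root_char char_poly_conj //.
rewrite char_poly_diag /root horner_prod; split=> [/prodf_eq0[i _]|[i ->]].
  by rewrite hornerXsubC subr_eq0 => /eqP ->; exists i.
by apply/prodf_eq0; exists i; rewrite // hornerXsubC subrr.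
Qed.

Lemma eigenvalue_ge0 N a :
  (forall x, 0 <= qform N x) -> eigenvalue N a -> 0 <= a.
Proof.
move=> Npos /eigenvalueP[v vN v0]; have := Npos v^T.
rewrite /qform trmxK vN -scalemxAl mxE -{1}[v]trmxK -[X in _ * X]/(normsq v^T).
by rewrite pmulr_lge0 // normsq_gt0 -trmx0 (inj_eq trmx_inj).
Qed.

(** Scaling the eigenvectors of [P] makes [P] the identity; an orthogonal
    diagonalization of the transformed [N] keeps it so. *)
Lemma simultaneous_diagonalization P N :
  P^T = P -> N^T = N -> (forall x, x != 0 -> 0 < qform P x) ->
  exists (Y : 'M[R]_k) d, Y^T *m P *m Y = 1%:M /\ Y^T *m N *m Y = diag_mx d.
Proof.
move=> Psym Nsym; have [U [p [UU PE]]] := spectral_theorem Psym => Ppos.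
have p_gt0 i : 0 < p 0 i.
  have -> : p 0 i = qform P (U^T *m delta_mx i 0).
    rewrite PE qform_orthodiag mulmxA UU mul1mx qform_diag (bigD1 i) //=.
    rewrite mxE !eqxx expr1n mulr1 big1 ?addr0 // => j ji.
    by rewrite mxE (negPf ji) expr0n mulr0.
  apply: Ppos; apply/eqP => /(congr1 (mulmx U)); rewrite mulmxA UU.
  by rewrite mul1mx mulmx0 => /matrixP/(_ i 0)/eqP;
     rewrite !mxE !eqxx oner_eq0.
pose r : 'rV[R]_k := \row_i (Num.sqrt (p 0 i))^-1.
pose Y0 : 'M[R]_k := U^T *m diag_mx r.
have Y0P : Y0^T *m P *m Y0 = 1%:M.
  rewrite PE /Y0 trmx_mul tr_diag_mx trmxK !mulmxA -(mulmxA _ U) UU mulmx1.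
  rewrite -(mulmxA _ U) UU mulmx1 !mulmx_diag -diag_const_mx; congr diag_mx.
  apply/rowP => i; rewrite !mxE mulrAC -invfM -expr2 sqr_sqrtr ?ltW //.
  by rewrite mulVf // gt_eqF.
clearbody Y0.
have Y0Nsym : (Y0^T *m N *m Y0)^T = Y0^T *m N *m Y0.
  by rewrite !trmx_mul trmxK Nsym mulmxA.
have [V [d [VV NE]]] := spectral_theorem Y0Nsym.
exists (Y0 *m V^T), d; rewrite trmx_mul trmxK; split.
  by rewrite !mulmxA -(mulmxA V) -(mulmxA V) Y0P mulmx1 VV.
rewrite !mulmxA -(mulmxA V) -(mulmxA V) NE !mulmxA VV mul1mx.
by rewrite -mulmxA VV mulmx1.
Qed.

End RealClosed.

(** * Extreme eigenvalues, singular values and square roots *)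

Section Extremal.
Variables (R : realType) (k : nat).
Implicit Types (N : 'M[R]_k).

(** In an orthonormal eigenbasis the form is a combination of the squared
    coordinates, weighted by the eigenvalues. *)
Lemma qform_le_lambda_max N (x : 'cV[R]_k) : N^T = N ->
  qform N x <= lambda_max N * normsq x.
Proof.
move=> /spectral_theorem[U [d [UU ->]]].
rewrite qform_orthodiag qform_diag -(normsq_orthogonal x UU) normsqE mulr_sumr.
apply: ler_sum => i _; rewrite ler_wpM2r ?sqr_ge0 //; apply: ub_le_sup.
  exists (\sum_j `|d 0 j|) => a /(eigenvalue_orthodiag _ _ UU)[j ->].
  by rewrite (le_trans (ler_norm _)) // (bigD1 j) //= lerDl sumr_ge0.
by apply/eigenvalue_orthodiag => //; exists i.
Qed.

Lemma lambda_min_le_qform N (x : 'cV[R]_k) : N^T = N ->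
  lambda_min N * normsq x <= qform N x.
Proof.
move=> /spectral_theorem[U [d [UU ->]]].
rewrite qform_orthodiag qform_diag -(normsq_orthogonal x UU) normsqE mulr_sumr.
apply: ler_sum => i _; rewrite ler_wpM2r ?sqr_ge0 //; apply: ge_inf.
  exists (- \sum_j `|d 0 j|) => a /(eigenvalue_orthodiag _ _ UU)[j ->].
  rewrite lerNl (le_trans (ler_norm _)) // normrN.
  by rewrite (bigD1 j) //= lerDl sumr_ge0.
by apply/eigenvalue_orthodiag => //; exists i.
Qed.

Lemma lambda_min_ge0 N : (forall x, 0 <= qform N x) -> 0 <= lambda_min N.
Proof.
move=> Npos; rewrite /lambda_min.
have [->|/set0P N0] := eqVneq [set a | eigenvalue N a]%classic set0.
  by rewrite inf0.
by apply: lb_le_inf => // a; apply: eigenvalue_ge0.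
Qed.

Lemma lambda_max_ge0 N : (forall x, 0 <= qform N x) -> 0 <= lambda_max N.
Proof.
move=> Npos; rewrite /lambda_max.
have [[N0 Nub]|/sup_out->//] :=
  pselect (has_sup [set a | eigenvalue N a]%classic).
have [a Na] := N0.
exact: le_trans (eigenvalue_ge0 Npos Na) (ub_le_sup Nub Na).
Qed.

Lemma sqrtmxP N : psdmx N -> psdmx (sqrtmx N) /\ sqrtmx N *m sqrtmx N = N.
Proof.
case=> /symmetric_trP Nsym Npos.
apply: (@xgetPex _ 0 [set S | psdmx S /\ S *m S = N]%classic).
move: Npos.
have [U [d [UU NE]]] := spectral_theorem Nsym => Npos.
have d_ge0 i : 0 <= d 0 i.
  apply: (@eigenvalue_ge0 _ _ N) => [//|]; rewrite NE.
  by apply/eigenvalue_orthodiag => //; exists i.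
pose r : 'rV[R]_k := \row_i Num.sqrt (d 0 i).
exists (U^T *m diag_mx r *m U); split; last first.
  rewrite [RHS]NE -!mulmxA (mulmxA U) UU mul1mx (mulmxA (diag_mx r)) mulmx_diag.
  by congr (_ *m (diag_mx _ *m _)); apply/rowP => i;
     rewrite !mxE -expr2 sqr_sqrtr.
split=> [|x].
  by apply/symmetric_trP; rewrite !trmx_mul tr_diag_mx trmxK mulmxA.
rewrite -[X in 0 <= X]/(qform _ x) qform_orthodiag qform_diag.
rewrite sumr_ge0 // => i _.
by rewrite mulr_ge0 ?sqr_ge0 // mxE sqrtr_ge0.
Qed.

End Extremal.

Section Gram.
Variables (R : realType) (p q : nat) (X : 'M[R]_(p, q)).

Lemma gram_sym : (X *m X^T)^T = X *m X^T.
Proof. by rewrite trmx_mul trmxK. Qed.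

Lemma gram_ge0 (x : 'cV[R]_p) : 0 <= qform (X *m X^T) x.
Proof. by rewrite qform_gram normsq_ge0. Qed.

End Gram.

(** The Gram matrix in [sigma_max X] is [X^T *m X], whereas the bound concerns
    [X *m X^T].  With [y = X^T *m x], Cauchy-Schwarz for [x] and [X *m y] gives
    [|y|^4 <= |x|^2 * |X y|^2 <= |x|^2 * l * |y|^2], [l] being the largest
    eigenvalue of [X^T *m X]. *)
Lemma normsq_tr_le_sigma_max (R : realType) p q (X : 'M[R]_(p, q)) x :
  normsq (X^T *m x) <= sigma_max X ^+ 2 * normsq x.
Proof.
have Gsym : (X^T *m X)^T = X^T *m X by rewrite trmx_mul trmxK.
have Gpos z : qform (X^T *m X) z = normsq (X *m z).
  by have := qform_gram X^T z; rewrite trmxK.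
have l0 : 0 <= lambda_max (X^T *m X).
  by apply: lambda_max_ge0 => z; rewrite Gpos normsq_ge0.
rewrite /sigma_max sqr_sqrtr //; set l := lambda_max _ in l0 *.
set y := X^T *m x.
have yE : normsq y = (x^T *m (X *m y)) 0 0.
  by rewrite /normsq {1}/y trmx_mul trmxK mulmxA.
have le_l : normsq (X *m y) <= l * normsq y.
  by rewrite -Gpos; apply: qform_le_lambda_max.
(* Cauchy-Schwarz in polynomial form; it is used at [t = l]. *)
have cs t : 2 * t * normsq y <= t ^+ 2 * normsq x + normsq (X *m y).
  have : 0 <= normsq (t *: x - X *m y) by apply: normsq_ge0.
  have -> : normsq (t *: x - X *m y)
            = t ^+ 2 * normsq x - 2 * t * normsq y + normsq (X *m y).
    rewrite yE !normsqE [(_ *m (X *m y)) 0 0]mxE.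
    rewrite !mulr_sumr -sumrN -!big_split /=; apply: eq_bigr => i _.
    by rewrite !mxE; ring.
  lra.
have [l_eq0|l_neq0] := eqVneq l 0.
  have Xy0 : normsq (X *m y) = 0.
    by apply/le_anti; rewrite normsq_ge0 andbT (le_trans le_l) // l_eq0 mul0r.
  have y0 : normsq y = 0.
    move: Xy0 => /eqP; rewrite normsq_eq0 => /eqP Xy0.
    by rewrite yE Xy0 mulmx0 mxE.
  by rewrite y0 l_eq0 mul0r.
have l_gt0 : 0 < l by rewrite lt_neqAle eq_sym l_neq0.
rewrite -(ler_pM2l l_gt0); have := cs l; nra.
Qed.

(** * Eigenvalues of a definite symmetric pencil *)

(** Keeping only the rows with a nonzero diagonal entry leaves a matrix with an
    explicit right inverse. *)
Lemma leq_rank_diag (F : fieldType) k (d : 'rV[F]_k) :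
  (#|[pred i | (d 0 i != 0)%R]| <= \rank (diag_mx d))%N.
Proof.
pose f := @enum_val _ [pred i | d 0 i != 0].
have free_f : row_free (rowsub f (diag_mx d)).
  apply/row_freeP; exists (colsub f (diag_mx (\row_i (d 0 i)^-1))).
  apply/matrixP => i j.
  have -> : (rowsub f (diag_mx d) *m colsub f (diag_mx (\row_i (d 0 i)^-1))) i j
            = (diag_mx d *m diag_mx (\row_i (d 0 i)^-1)) (f i) (f j).
    by rewrite !mxE; apply: eq_bigr => l _; rewrite !mxE.
  rewrite mulmx_diag !mxE (inj_eq enum_val_inj) mulfV //.
  exact: (enum_valP i).
by rewrite -(eqP free_f) mxrankS // rowsub_sub.
Qed.

Lemma perm_nseq_count (T : eqType) (a : T) (s : seq T) c :
  (c <= count_mem a s)%N -> exists t, perm_eq s (nseq c a ++ t).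
Proof.
elim: s c => [|b s IHs] [|c] //= cle; try by exists (b :: s).
  by exists [::].
have [ba|ba] := eqVneq b a.
  move: cle; rewrite ba eqxx add1n ltnS => /IHs[t st]; exists t.
  by rewrite perm_cons.
move: cle; rewrite (negPf ba) add0n => /IHs[t st]; exists (b :: t).
by rewrite -cat_cons perm_sym perm_catC /= perm_cons perm_catC perm_sym.
Qed.

(** A congruence [Y] with [Y^T *m P *m Y = 1%:M] and [Y^T *m N *m Y = diag_mx d]
    satisfies [P^-1 = Y *m Y^T], so [P^-1 *m N] is similar to [diag_mx d].
    Column [i] of [Y] exhibits [d 0 i] as a quotient of the two forms, and the
    number of [i] with [d 0 i != 1] is the rank of [Y^T *m (N - P) *m Y]. *)
Lemma pencil_eigenvalues (R : realType) k (P N : 'M[R]_k) c :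
  P^T = P -> N^T = N -> (forall x, x != 0 -> 0 < qform P x) ->
  (c <= k - \rank (N - P)%R)%N ->
  exists s : seq R,
    eigenvalues_with_mult (invmx P *m N) (nseq c 1 ++ s) /\
    forall lo hi,
      (forall x, lo * qform P x <= qform N x <= hi * qform P x) ->
      forall a, a \in s -> lo <= a <= hi.
Proof.
move=> Psym Nsym Ppos cr.
have [Y [d [YP YN]]] := simultaneous_diagonalization Psym Nsym Ppos.
have YYP : Y *m (Y^T *m P) = 1%:M by rewrite (mulmx1C YP).
have invP : invmx P = Y *m Y^T.
  have YYP1 : Y *m Y^T *m P = 1%:M by rewrite -mulmxA.
  have [_ Pu] := mulmx1_unit YYP1.
  by rewrite -[RHS]mulmx1 -(mulmxV Pu) mulmxA YYP1 mul1mx.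
set r := \rank (N - P) in cr *.
pose L := [seq d 0 i | i : 'I_k].
have ones : (k - r <= count_mem 1%R L)%N.
  have rk : (#|[pred i | (d 0 i != 1)%R]| <= r)%N.
    have -> : #|[pred i | d 0 i != 1]|
              = #|[pred i | (d - const_mx 1) 0 i != 0]|.
      by apply: eq_card => i; rewrite !inE !mxE subr_eq0.
    apply: leq_trans (leq_rank_diag _) _.
    have -> : diag_mx (d - const_mx 1) = Y^T *m (N - P) *m Y.
      by rewrite mulmxBr mulmxBl YP YN linearB /= diag_const_mx.
    exact: leq_trans (mxrankM_maxl _ _) (mxrankM_maxr _ _).
  rewrite leq_subLR -{1}(card_ord k) -(cardC [pred i | d 0 i != 1]) leq_add //.
  rewrite count_map -size_filter enumT cardE /enum_mem eq_leq //; congr size.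
  by apply: eq_filter => i; rewrite !inE negbK eq_sym.
have [s ds] := perm_nseq_count (leq_trans cr ones); exists s; split.
  rewrite /eigenvalues_with_mult -(perm_big _ ds) /= big_image /=.
  rewrite -char_poly_diag.
  have -> : invmx P *m N = Y *m diag_mx d *m (Y^T *m P).
    by rewrite invP -YN -!mulmxA YYP mulmx1.
  exact: char_poly_conj.
move=> lo hi bounds a sa.
have /mapP[i _ ->] : a \in L.
  by rewrite (perm_mem ds) mem_cat sa orbT.
have qY Z : qform Z (Y *m delta_mx i 0) = (Y^T *m Z *m Y) i i.
  transitivity ((delta_mx 0 i *m (Y^T *m Z *m Y) *m delta_mx i 0 : 'M_1) 0 0).
    by rewrite /qform trmx_mul trmx_delta !mulmxA.
  by rewrite -rowE -colE mxE [LHS]mxE.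
by have := bounds (Y *m delta_mx i 0); rewrite !qY YP YN !mxE eqxx !mulr1.
Qed.

(** * The block preconditioner of a regularized Gram matrix *)

Section BlockBounds.
Variables (R : realType) (kr mr kc nc : nat) (delta : R).
Variables (B11 : 'M[R]_(kr, kc)) (B12 : 'M[R]_(kr, nc)).
Variables (B21 : 'M[R]_(mr, kc)) (B22 : 'M[R]_(mr, nc)).
Hypothesis delta_gt0 : 0 < delta.

Let B := block_mx B11 B12 B21 B22.
Let W := B *m B^T + delta%:M.
Let P := PNE delta B.
Let frac := lambda_max (B21 *m B21^T) / (delta + lambda_min (B22 *m B22^T)).

Lemma PNE_block : P = block_mx (B11 *m B11^T + B12 *m B12^T + delta%:M) 0
                               0 (B22 *m B22^T + delta%:M).
Proof.
rewrite /P /B /PNE /Mtilde22 /Mhat22 /Mhat11.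
rewrite block_mxKul block_mxKur block_mxKdl block_mxKdr; congr block_mx.
by rewrite -[X in X - _]addrA addrAC subrr add0r.
Qed.

Lemma PNE_sym : P^T = P.
Proof.
by rewrite PNE_block tr_block_mx !linearD /= !gram_sym !tr_scalar_mx !trmx0.
Qed.

Lemma normal_matrix_sym : W^T = W.
Proof. by rewrite linearD /= gram_sym tr_scalar_mx. Qed.

Lemma qform_PNE (x : 'cV[R]_kr) (y : 'cV[R]_mr) :
  qform P (col_mx x y) =
    (normsq (B11^T *m x) + normsq (B12^T *m x) + delta * normsq x)
    + (normsq (B22^T *m y) + delta * normsq y).
Proof.
rewrite PNE_block /qform tr_col_mx mul_row_block mul_row_col.
rewrite !mulmx0 addr0 add0r mxE -!/(qform _ _) !qformDscalar qform_gram.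
by rewrite {1}/qform mulmxDr mulmxDl mxE -!/(qform _ _) !qform_gram.
Qed.

Lemma qform_normal_matrix (x : 'cV[R]_kr) (y : 'cV[R]_mr) :
  qform W (col_mx x y) =
    normsq (B11^T *m x + B21^T *m y) + normsq (B12^T *m x + B22^T *m y)
    + delta * (normsq x + normsq y).
Proof.
rewrite /W qformDscalar qform_gram /B tr_block_mx mul_block_col.
by rewrite !normsq_col_mx.
Qed.

Lemma PNE_gt0 (z : 'cV[R]_(kr + mr)) : z != 0 -> 0 < qform P z.
Proof.
rewrite -normsq_gt0 -[z]vsubmxK qform_PNE normsq_col_mx => z_gt0.
have := mulr_gt0 delta_gt0 z_gt0; rewrite mulrDr.
have := normsq_ge0 (B11^T *m usubmx z); have := normsq_ge0 (B12^T *m usubmx z).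
have := normsq_ge0 (B22^T *m dsubmx z); lra.
Qed.

(** The upper block row has [kr] rows.  The lower one factors through
    [row_mx Z B21], which has [kr + kc] columns. *)
Lemma rank_normal_matrix_sub_PNE : (\rank (W - P)%R <= 2 * kr + kc)%N.
Proof.
have -> : W - P = block_mx 0 (B11 *m B21^T + B12 *m B22^T)
                    (B21 *m B11^T + B22 *m B12^T) (B21 *m B21^T).
  rewrite PNE_block /W /B tr_block_mx mulmx_block scalar_mx_block.
  rewrite add_block_mx opp_block_mx add_block_mx !subr0 !addr0; congr block_mx.
    by rewrite subrr.
  by rewrite opprD addrACA subrr addr0 addrK.
set X := _ + _; set Z := _ + _.
have -> : block_mx 0 X Z (B21 *m B21^T)
          = col_mx (row_mx 0 X) (row_mx Z B21 *m block_mx 1%:M 0 0 B21^T).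
  by rewrite mul_row_block !mulmx0 mulmx1 addr0 add0r.
rewrite -addsmxE (leq_trans (mxrank_adds_leqif _ _)) // mul2n -addnn -addnA.
by rewrite leq_add ?rank_leq_row // (leq_trans (mulmx_max_rank _ _)).
Qed.

Lemma normsq_B21_le (y : 'cV[R]_mr) :
  normsq (B21^T *m y) <= frac * (normsq (B22^T *m y) + delta * normsq y).
Proof.
have lmax0 := lambda_max_ge0 (gram_ge0 B21).
have lmin0 := lambda_min_ge0 (gram_ge0 B22).
have d0 : 0 < delta + lambda_min (B22 *m B22^T) by rewrite ltr_wpDr.
have := qform_le_lambda_max y (gram_sym B21); rewrite qform_gram.
move=> /le_trans; apply.
rewrite /frac -mulrA ler_wpM2l // mulrC ler_pdivlMr // mulrC.
rewrite mulrDl addrC lerD2r.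
by rewrite -qform_gram lambda_min_le_qform ?gram_sym.
Qed.

Lemma frac_ge0 : 0 <= frac.
Proof.
rewrite divr_ge0 ?lambda_max_ge0 ?addr_ge0 ?lambda_min_ge0 ?ltW //.
  exact: gram_ge0.
exact: gram_ge0.
Qed.

(** The weight [1 + f] in [normsqD_le] turns the coefficients of both parts into
    [2 + f], because [(1 + (1 + f)^-1) * (1 + f) = 2 + f].  Stating this for
    every admissible [f] covers the case of an empty [B21], where [f = 0]. *)
Lemma normal_matrix_le_PNE f : 0 <= f ->
  (forall y, normsq (B21^T *m y)
             <= f * (normsq (B22^T *m y) + delta * normsq y)) ->
  forall z, qform W z <= (2 + f) * qform P z.
Proof.
move=> f0 fB z; rewrite -[z]vsubmxK qform_normal_matrix qform_PNE.
set x := usubmx z; set y := dsubmx z.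
have s0 : 0 < 1 + f by lra.
have i0 : 0 <= (1 + f)^-1 by rewrite invr_ge0 ltW.
have e1 := normsqD_le (B11^T *m x) (B21^T *m y) s0.
have e2 := normsqD_le (B12^T *m x) (B22^T *m y) s0.
have e3 : (1 + (1 + f)^-1)
            * ((1 + f) * (normsq (B22^T *m y) + delta * normsq y))
          = (2 + f) * (normsq (B22^T *m y) + delta * normsq y).
  by field; rewrite gt_eqF.
have e4 := ler_wpM2l (addr_ge0 ler01 i0) (fB y).
have dx := mulr_ge0 (ltW delta_gt0) (normsq_ge0 x).
have dy := mulr_ge0 (ltW delta_gt0) (normsq_ge0 y).
have fdx := mulr_ge0 f0 dx; have idy := mulr_ge0 i0 dy.
have := normsq_ge0 (B12^T *m x); have := normsq_ge0 (B11^T *m x).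
lra.
Qed.

Lemma PNE_le_normal_matrix z :
  delta / (delta + sigma_max B ^+ 2) * qform P z <= qform W z.
Proof.
have den_gt0 : 0 < delta + sigma_max B ^+ 2 by rewrite ltr_wpDr ?sqr_ge0.
have BT x y : B^T *m col_mx x y
    = col_mx (B11^T *m x + B21^T *m y) (B12^T *m x + B22^T *m y).
  by rewrite /B tr_block_mx mul_block_col.
have Bx x : normsq (B11^T *m x) + normsq (B12^T *m x)
    <= sigma_max B ^+ 2 * normsq x.
  have := normsq_tr_le_sigma_max B (col_mx x 0).
  by rewrite BT !mulmx0 !addr0 !normsq_col_mx normsq0 addr0.
have By y : normsq (B22^T *m y) <= sigma_max B ^+ 2 * normsq y.
  have := normsq_tr_le_sigma_max B (col_mx 0 y).
  rewrite BT !mulmx0 !add0r !normsq_col_mx normsq0 add0r; apply: le_trans.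
  by rewrite lerDr normsq_ge0.
have PN : qform P z <= (delta + sigma_max B ^+ 2) * normsq z.
  rewrite -[z]vsubmxK qform_PNE normsq_col_mx.
  by have := Bx (usubmx z); have := By (dsubmx z); lra.
have NW : delta * normsq z <= qform W z by rewrite qformDscalar lerDr gram_ge0.
rewrite mulrAC ler_pdivrMr // [leRHS]mulrC.
apply: le_trans (ler_wpM2l (ltW delta_gt0) PN) _.
by rewrite mulrCA ler_wpM2l // ltW.
Qed.

Lemma normal_matrix_bounds_kr0 z : kr = 0%N ->
  qform P z <= qform W z <= (1 + frac) * qform P z.
Proof.
move=> kr0; rewrite -[z]vsubmxK qform_normal_matrix qform_PNE.
have -> : usubmx z = 0.
  by apply/matrixP => -[i ik]; exfalso; rewrite kr0 in ik.
rewrite !mulmx0 !add0r !normsq0 mulr0 !add0r.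
have := normsq_B21_le (dsubmx z); have := normsq_ge0 (B21^T *m dsubmx z); lra.
Qed.

End BlockBounds.

(** * Reduction of the normal equations to a Gram matrix *)

Lemma perm_mx_orthogonal (R : comNzRingType) k (S : 'M[R]_k) :
  is_perm_mx S -> S *m S^T = 1%:M.
Proof.
case/is_perm_mxP => s ->; rewrite tr_perm_mx -perm_mxM.
by rewrite mulgV perm_mx1.
Qed.

Lemma congruence_psd (R : realType) p q (N : 'M[R]_p) (X : 'M[R]_(p, q)) :
  psdmx N -> psdmx (X^T *m N *m X).
Proof.
case=> /symmetric_trP Nsym Npos; split=> [|x].
  by apply/symmetric_trP; rewrite !trmx_mul trmxK Nsym mulmxA.
by have := Npos (X *m x); rewrite trmx_mul !mulmxA.
Qed.

Lemma Diag_psd (R : realType) k (N : 'M[R]_k) : psdmx N -> psdmx (Diag N).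
Proof.
case=> _ Npos; split=> [|x]; first by apply/symmetric_trP; rewrite tr_diag_mx.
rewrite -[X in 0 <= X]/(qform _ x) qform_diag sumr_ge0 // => i _.
rewrite mulr_ge0 ?sqr_ge0 // mxE; have := Npos (delta_mx i 0).
by rewrite trmx_delta -rowE -colE mxE [X in _ <= X]mxE.
Qed.

Lemma block_diag_psd (R : realType) p q (N1 : 'M[R]_p) (N2 : 'M[R]_q) :
  psdmx N1 -> psdmx N2 -> psdmx (block_mx N1 0 0 N2).
Proof.
case=> /symmetric_trP N1sym N1pos [/symmetric_trP N2sym N2pos]; split=> [|x].
  by apply/symmetric_trP; rewrite tr_block_mx N1sym N2sym !trmx0.
rewrite -[x]vsubmxK tr_col_mx mul_row_block mul_row_col !mulmx0 addr0 add0r.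
by rewrite mxE addr_ge0.
Qed.

(** The blocks [Q1] and [Q2] are compressions of [Pc^T *m Q *m Pc] to coordinate
    subspaces, hence positive semi-definite. *)
Lemma Qhat_psd (R : realType) kc nc (Q Pc : 'M[R]_(kc + nc)) Qh1 Qh2 :
  psdmx Q ->
  Qh1 = Q1 Pc Q \/ Qh1 = Diag (Q1 Pc Q) ->
  Qh2 = Q2 Pc Q \/ Qh2 = Diag (Q2 Pc Q) ->
  psdmx (Qhat Pc Qh1 Qh2).
Proof.
move=> Qpsd hQ1 hQ2; have Npsd := congruence_psd Pc Qpsd.
have Q1psd : psdmx (Q1 Pc Q).
  have := congruence_psd (col_mx 1%:M 0) Npsd; rewrite -[Pc^T *m _ *m _]submxK.
  rewrite tr_col_mx mul_row_block mul_row_col trmx1 trmx0 !mul0mx !mulmx0.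
  by rewrite !addr0 mul1mx mulmx1.
have Q2psd : psdmx (Q2 Pc Q).
  have := congruence_psd (col_mx 0 1%:M) Npsd; rewrite -[Pc^T *m _ *m _]submxK.
  rewrite tr_col_mx mul_row_block mul_row_col trmx1 trmx0 !mul0mx !mulmx0.
  by rewrite !add0r mul1mx mulmx1.
rewrite /Qhat -{1}[Pc]trmxK; apply: congruence_psd; apply: block_diag_psd.
  by case: hQ1 => ->; [|exact: Diag_psd].
by case: hQ2 => ->; [|exact: Diag_psd].
Qed.

(** With [N] symmetric and invertible, [N^-1 = (N^-1)^T *m N *m N^-1] is a
    congruence of [N]. *)
Lemma Ghat_psd (R : realType) kc nc rho (Qh : 'M[R]_(kc + nc)) :
  0 < rho -> psdmx Qh -> psdmx (Ghat rho Qh).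
Proof.
move=> rho0 [/symmetric_trP Qsym Qpos].
set N := Qh + rho%:M.
have Nsym : N^T = N by rewrite linearD /= Qsym tr_scalar_mx.
have Npos x : x != 0 -> 0 < qform N x.
  rewrite -normsq_gt0 => x0; rewrite qformDscalar ltr_wpDl ?mulr_gt0 //.
  exact: Qpos.
have Nu : N \in unitmx.
  have [Y [d [YNY _]]] := simultaneous_diagonalization Nsym Nsym Npos.
  by have := mulmx1_unit YNY; rewrite unitmx_mul => -[/andP[]].
have iE : invmx N = (invmx N)^T *m N *m invmx N.
  by rewrite trmx_inv Nsym mulVmx // mul1mx.
rewrite /Ghat -/N iE; apply: congruence_psd; split=> [|x].
  exact/symmetric_trP.
have [->|/Npos/ltW//] := eqVneq x 0; by rewrite mulmx0 mxE.
Qed.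

Lemma normal_matrix_gram (R : realType) kr mr kc nc
    (A : 'M[R]_(kr + mr, kc + nc))
    rho delta (Pc : 'M[R]_(kc + nc)) (Pr : 'M[R]_(kr + mr)) Qh :
  is_perm_mx Pc -> is_perm_mx Pr -> psdmx (Ghat rho Qh) ->
  let B := Bmx A rho Pc Pr Qh in
  Pr *m Mhat A rho delta Qh *m Pr^T = B *m B^T + delta%:M.
Proof.
move=> /perm_mx_orthogonal Pc1 /perm_mx_orthogonal Pr1 /sqrtmxP[].
case=> /symmetric_trP Ssym _ SS B; rewrite /B /Bmx /Mhat.
rewrite mulmxDr mulmxDl mul_mx_scalar -scalemxAl Pr1 scalemx1; congr (_ + _).
by rewrite -{1}SS !trmx_mul Ssym !mulmxA -(mulmxA _ Pc) Pc1 mulmx1.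
Qed.

Theorem theorem2p1 (R : realType) (kr mr kc nc : nat)
  (hmn : (kr + mr <= kc + nc)%N)
  (A : 'M[R]_(kr + mr, kc + nc)) (Q : 'M[R]_(kc + nc)) (hQ : psdmx Q)
  (delta rho : R) (hdelta : 0 < delta) (hrho : 0 < rho)
  (Pc : 'M[R]_(kc + nc)) (hPc : is_perm_mx Pc)
  (Pr : 'M[R]_(kr + mr)) (hPr : is_perm_mx Pr)
  (Qh1 : 'M[R]_kc) (hQh1 : Qh1 = Q1 Pc Q \/ Qh1 = Diag (Q1 Pc Q))
  (Qh2 : 'M[R]_nc) (hQh2 : Qh2 = Q2 Pc Q \/ Qh2 = Diag (Q2 Pc Q)) :
  let m := (kr + mr)%N in
  let Qh := Qhat Pc Qh1 Qh2 in
  let M := Mhat A rho delta Qh in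
  let B := Bmx A rho Pc Pr Qh in
  let B21 := dlsubmx B in
  let B22 := drsubmx B in
  let lo := delta / (delta + sigma_max B ^+ 2) in
  let frac := lambda_max (B21 *m B21^T)
                / (delta + lambda_min (B22 *m B22^T)) in
  exists s : seq R,
    [/\ eigenvalues_with_mult (invmx (PNE delta B) *m (Pr *m M *m Pr^T))
          (nseq (m - (2 * kr + kc))%N 1 ++ s),
        (0 < kc)%N -> (0 < kr)%N ->
          forall a : R, a \in s -> lo <= a <= 2 + frac,
        (0 < kc)%N -> kr = 0%N ->
          forall a : R, a \in s -> 1 <= a <= 1 + frac
      & (0 < kr)%N -> kc = 0%N ->
          forall a : R, a \in s -> lo <= a <= 2].
Proof.
move=> m Qh M B B21 B22 lo frac.
have Gpsd : psdmx (Ghat rho Qh) := Ghat_psd hrho (Qhat_psd hQ hQh1 hQh2).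
have -> : Pr *m M *m Pr^T = B *m B^T + delta%:M by exact: normal_matrix_gram.
have BE : B = block_mx (ulsubmx B) (ursubmx B) B21 B22 by rewrite submxK.
have rk := rank_normal_matrix_sub_PNE delta (ulsubmx B) (ursubmx B) B21 B22.
have Psym := PNE_sym delta (ulsubmx B) (ursubmx B) B21 B22.
have Wsym := normal_matrix_sym delta (ulsubmx B) (ursubmx B) B21 B22.
have Ppos := PNE_gt0 (ulsubmx B) (ursubmx B) B21 B22 hdelta.
have low := PNE_le_normal_matrix (ulsubmx B) (ursubmx B) B21 B22 hdelta.
have up := @normal_matrix_le_PNE _ _ _ _ _ _
  (ulsubmx B) (ursubmx B) B21 B22 hdelta.
have up21 := normsq_B21_le B21 B22 hdelta.
have kr0 := normal_matrix_bounds_kr0 (ulsubmx B) (ursubmx B) B21 B22 hdelta.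
rewrite -BE -/lo -/frac in rk Psym Wsym Ppos low up up21 kr0.
have cr : (m - (2 * kr + kc)
           <= m - \rank (B *m B^T + delta%:M - PNE delta B)%R)%N.
  exact: leq_sub2l.
have [s [sE sbounds]] := pencil_eigenvalues Psym Wsym Ppos cr.
exists s; split; first exact: sE.
- by move=> _ _; apply: sbounds => x; rewrite low up // frac_ge0.
- by move=> _ kr_eq0; apply: sbounds => x; rewrite mul1r kr0.
- move=> _ kc_eq0; apply: sbounds => x; rewrite low -[2]addr0 up // => y.
  have -> : B21^T *m y = 0.
    by apply/matrixP => -[i ik]; exfalso; rewrite kc_eq0 in ik.
  by rewrite mul0r normsq0.
Qed.
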